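(* For any online bilevel optimization (OBO) algorithm, there always exists a sequence of smooth and strongly convex functions $\{(f_t,g_t)\}_{t=1}^T$ such that $$\mathrm{BD\text{-}Reg}_T=\Omega(1+S_{2,T}).$$ That is, there is an absolute constant $c>0$ such that for every OBO algorithm and every horizon $T$ there is an OBO problem instance (a decision set $\mathcal{X}$ together with functions $\{(f_t,g_t)\}_{t=1}^T$ that are smooth and strongly convex) on which the decisions of the algorithm satisfy $\mathrm{BD\text{-}Reg}_T\ge c\,(1+S_{2,T})$.
   Context: An OBO instance consists of a closed convex decision set $\mathcal{X}\subseteq\mathbb{R}^{d_1}$ (possibly $\mathcal{X}=\mathbb{R}^{d_1}$) and functions $f_t,g_t:\mathcal{X}\times\mathbb{R}^{d_2}\to\mathbb{R}$, $t=1,\dots,T$. ''Smooth and strongly convex'' means: $f_t$ and $g_t$ have Lipschitz continuous gradients, $\mathbf{y}\mapsto g_t(\mathbf{x},\mathbf{y})$ is strongly convex for every $\mathbf{x}$, and $\mathbf{x}\mapsto f_t(\mathbf{x},\mathbf{y}_t^*(\mathbf{x}))$ is strongly convex, where $\mathbf{y}_t^*(\mathbf{x})=\arg\min_{\mathbf{y}\in\mathbb{R}^{d_2}}g_t(\mathbf{x},\mathbf{y})$. Put $\mathbf{x}_t^*\in\arg\min_{\mathbf{x}\in\mathcal{X}}f_t(\mathbf{x},\mathbf{y}_t^*(\mathbf{x}))$. An OBO algorithm chooses, at each round $t$, a decision $\mathbf{x}_t\in\mathcal{X}$ as a function only of information from previous rounds, i.e. of $(f_1,g_1),\dots,(f_{t-1},g_{t-1})$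 (in particular $\mathbf{x}_t$ does not depend on $f_t,g_t$). Bilevel dynamic regret: $\mathrm{BD\text{-}Reg}_T=\sum_{t=1}^T\big(f_t(\mathbf{x}_t,\mathbf{y}_t^*(\mathbf{x}_t))-f_t(\mathbf{x}_t^*,\mathbf{y}_t^*(\mathbf{x}_t^* ))\big)$. $S_{2,T}=P_{2,T}+Y_{2,T}$ with $P_{2,T}=\sum_{t=2}^T\|\mathbf{x}_{t-1}^*-\mathbf{x}_t^*\|^2$ and $Y_{2,T}=\sum_{t=2}^T\|\mathbf{y}_{t-1}^*(\mathbf{x}_{t-1}^* )-\mathbf{y}_t^*(\mathbf{x}_t^* )\|^2$. *)

(* Defs.v *)
From HB Require Import structures.
From mathcomp Require Import all_boot all_order all_algebra.
From mathcomp Require Import all_classical all_reals all_analysis.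

Set Implicit Arguments.
Unset Strict Implicit.
Unset Printing Implicit Defensive.

Import Order.TTheory GRing.Theory Num.Theory.
Import numFieldNormedType.Exports.

Local Open Scope classical_set_scope.
Local Open Scope ring_scope.

(* The library norm on 'rV[R]_n is the sup norm. *)
Definition enorm (R : realType) (n : nat) (u : 'rV[R]_n) : R :=
  Num.sqrt (\sum_i u ord0 i ^+ 2).

Record decision_set (R : realType) (d : nat) := DecisionSet {
  dset :> set 'rV[R]_d;
  dset_closed : closed dset;
  dset_convex : convex_set dset;
  dset_nonempty : dset !=set0 }.

(* The functions live on X * R^d2, so that an algorithm, which observes them,
   has no access to values outside X. *)
Definition objective (R : realType) (d1 d2 : nat) (X : set 'rV[R]_d1) : Type :=
  X -> 'rV[R]_d2 -> R.
Arguments objective {R d1} d2 X.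

Definition gradient (R : realType) (n : nat) (F : 'rV[R]_n -> R)
    (p : 'rV[R]_n) : 'rV[R]_n :=
  \row_i 'D_(delta_mx ord0 i) F p.

(* Lipschitz continuous gradient, jointly in (x, y). As X may have boundary
   points, or empty interior, the gradient on X * R^d2 is that of an extension
   F of f to the ambient space R^(d1 + d2) which is differentiable at the points
   of X * R^d2; nothing is required of F elsewhere. *)
Definition smooth (R : realType) (d1 d2 : nat) (X : set 'rV[R]_d1)
    (f : objective d2 X) : Prop :=
  exists F : 'rV[R]_(d1 + d2) -> R,
  [/\ forall (x : X) (y : 'rV[R]_d2), F (row_mx (val x) y) = f x y,
      forall (x : X) (y : 'rV[R]_d2), differentiable F (row_mx (val x) y)
    & exists L : R, forall (x x' : X) (y y' : 'rV[R]_d2),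
        enorm (gradient F (row_mx (val x) y) - gradient F (row_mx (val x') y'))
        <= L * enorm (row_mx (val x) y - row_mx (val x') y')].

(* The point z is the convex combination, which for convex D is again in D. *)
Definition strongly_convex (R : realType) (n : nat) (D : set 'rV[R]_n)
    (mu : R) (h : D -> R) : Prop :=
  0 < mu /\
  forall (x y z : D) (a : R), 0 <= a <= 1 ->
    val z = a *: val x + (1 - a) *: val y ->
    h z <= a * h x + (1 - a) * h y
           - mu / 2 * a * (1 - a) * enorm (val x - val y) ^+ 2.

Definition is_argmin (R : realType) (T : Type) (h : T -> R) (z : T) : Prop :=
  forall z' : T, h z <= h z'.

(* Rounds are numbered 1, ..., T; values at other indices are irrelevant.
   By strong convexity the minimizers ystar t x and xstar t are unique. *)
Record obo_instance (R : realType) (d1 d2 : nat) (X : set 'rV[R]_d1) (T : nat)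
    (f g : nat -> objective d2 X) (ystar : nat -> X -> 'rV[R]_d2)
    (xstar : nat -> X) : Prop := {
  obo_f_smooth : forall t, (1 <= t <= T)%N -> smooth (f t);
  obo_g_smooth : forall t, (1 <= t <= T)%N -> smooth (g t);
  obo_g_strongly_convex : forall t, (1 <= t <= T)%N ->
    exists mu : R, forall x : X,
      strongly_convex mu (fun y : [set: 'rV[R]_d2] => g t x (val y));
  obo_ystar : forall t, (1 <= t <= T)%N ->
    forall x : X, is_argmin (g t x) (ystar t x);
  obo_f_strongly_convex : forall t, (1 <= t <= T)%N ->
    exists mu : R, strongly_convex mu (fun x : X => f t x (ystar t x));
  obo_xstar : forall t, (1 <= t <= T)%N ->
    is_argmin (fun x : X => f t x (ystar t x)) (xstar t) }.

(* An algorithm knows the decision set and maps the list of the previously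
   revealed pairs of functions to its next decision. *)
Definition obo_algorithm (R : realType) (d1 d2 : nat) : Type :=
  forall X : decision_set R d1, seq (objective d2 X * objective d2 X) -> X.

Definition decision (R : realType) (d1 d2 : nat) (A : obo_algorithm R d1 d2)
    (X : decision_set R d1) (f g : nat -> objective d2 X) (t : nat) : X :=
  A X [seq (f s, g s) | s <- iota 1 t.-1].

Definition BD_Reg (R : realType) (d1 d2 : nat) (X : set 'rV[R]_d1) (T : nat)
    (f : nat -> objective d2 X) (ystar : nat -> X -> 'rV[R]_d2)
    (xstar x : nat -> X) : R :=
  \sum_(1 <= t < T.+1)
    (f t (x t) (ystar t (x t)) - f t (xstar t) (ystar t (xstar t))).

Definition P2 (R : realType) (d1 : nat) (X : set 'rV[R]_d1) (T : nat)
    (xstar : nat -> X) : R :=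
  \sum_(2 <= t < T.+1) enorm (val (xstar t.-1) - val (xstar t)) ^+ 2.

Definition Y2 (R : realType) (d1 d2 : nat) (X : set 'rV[R]_d1) (T : nat)
    (ystar : nat -> X -> 'rV[R]_d2) (xstar : nat -> X) : R :=
  \sum_(2 <= t < T.+1)
    enorm (ystar t.-1 (xstar t.-1) - ystar t (xstar t)) ^+ 2.

Definition S2 (R : realType) (d1 d2 : nat) (X : set 'rV[R]_d1) (T : nat)
    (ystar : nat -> X -> 'rV[R]_d2) (xstar : nat -> X) : R :=
  P2 T xstar + Y2 T ystar xstar.

(* Main.v *)
Require Import Defs.
From HB Require Import structures.
From mathcomp Require Import all_boot all_order all_algebra.
From mathcomp Require Import all_classical all_reals all_analysis.
From mathcomp Require Import ring lra.

Import Order.TTheory GRing.Theory Num.Theory.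
Import numFieldNormedType.Exports.

Local Open Scope classical_set_scope.
Local Open Scope ring_scope.

(** Since a decision is made before the round's functions are revealed, an
    adversary can always place the next minimizer on the far side of it. Take
    the whole space as decision set and, at round [t], the single quadratic
    [|x - s e1|^2 + |y - s e2|^2] as both the outer and the inner objective,
    where [e1], [e2] are unit vectors and [s] is a sign. The inner minimizer is
    [s e2] for every [x], so the outer problem is to minimize [|x - s e1|^2],
    whose minimizer is [s e1] with value [0].

    Choosing [s] opposite to the first coordinate of the decision
    ([opposite_sign_far]) costs the algorithm at least [1] in every round, so
    the regret is at least [T]. On the other hand both minimizers only move
    between two antipodal points at distance [2], hence each of the [T - 1]
    transitions adds at most [4] to each of the two squared path lengths, and
    [1 + S <= 1 + 8 (T - 1) <= 8 T]. This gives the constant [1/8].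

    The choice of signs is adaptive: each one depends on the decision taken
    after seeing all the previous ones ([adaptive_sequence]). Smoothness and
    strong convexity hold because every function in play is a squared Euclidean
    distance, up to a constant: its gradient is [2 (p - c)], and its convexity
    defect along a segment is exactly [a (1 - a) |x - y|^2]. *)

Lemma enorm_sqr {R : realType} {n : nat} (u : 'rV[R]_n) :
  enorm u ^+ 2 = \sum_i u ord0 i ^+ 2.
Proof. by rewrite sqr_sqrtr // sumr_ge0 // => i _; rewrite sqr_ge0. Qed.

Lemma enorm_sqr_row_mx {R : realType} {m n : nat}
    (u : 'rV[R]_m) (v : 'rV[R]_n) :
  enorm (row_mx u v) ^+ 2 = enorm u ^+ 2 + enorm v ^+ 2.
Proof.
rewrite !enorm_sqr big_split_ord /=.
by congr (_ + _); apply: eq_bigr => i _; rewrite ?row_mxEl ?row_mxEr.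
Qed.

Lemma enormZ {R : realType} {n : nat} (a : R) (u : 'rV[R]_n) :
  enorm (a *: u) = `|a| * enorm u.
Proof.
rewrite /enorm -sqrtr_sqr -sqrtrM ?sqr_ge0 // mulr_sumr.
by congr Num.sqrt; apply: eq_bigr => i _; rewrite mxE exprMn.
Qed.

Lemma enorm_delta {R : realType} {n : nat} (j : 'I_n) :
  enorm (delta_mx ord0 j : 'rV[R]_n) = 1.
Proof.
rewrite /enorm (bigD1 j) //= big1 => [|i ij]; first last.
  by rewrite mxE (negbTE ij) andbF expr0n.
by rewrite mxE !eqxx addr0 expr1n sqrtr1.
Qed.

Lemma le_coord_enorm_sqr {R : realType} {n : nat} (u : 'rV[R]_n) (j : 'I_n) :
  u ord0 j ^+ 2 <= enorm u ^+ 2.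
Proof.
by rewrite enorm_sqr (bigD1 j) //= lerDl sumr_ge0 // => i _; rewrite sqr_ge0.
Qed.

Lemma is_derive_coord {R : realType} {n : nat} (j : 'I_n) (p v : 'rV[R]_n) :
  is_derive p v (fun q : 'rV[R]_n => q ord0 j) (v ord0 j).
Proof.
apply: DeriveDef; first exact/diff_derivable/differentiable_coord.
apply: cvg_lim => //.
apply: (@cvg_trans _ ((fun=> v ord0 j) @ (0 : R)^')); last exact: cvg_cst.
apply: near_eq_cvg; near=> h.
rewrite /= !mxE addrK scalerA mulVf ?scale1r //.
by near: h; exact: nbhs_dnbhs_neq.
Unshelve. all: by end_near. Qed.

(** A sum of powers in the algebra of functions, the form to which the rules of
    differentiation apply. *)
Lemma sqdistE {R : realType} {n : nat} (c : 'rV[R]_n) :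
  (fun p : 'rV[R]_n => enorm (p - c) ^+ 2) =
  \sum_(i < n) ((fun p : 'rV[R]_n => p ord0 i) - cst (c ord0 i)) ^+ 2.
Proof.
apply/funext => p; rewrite enorm_sqr fct_sumE.
by apply: eq_bigr => i _; rewrite !mxE.
Qed.

Lemma differentiable_sqdist {R : realType} {n : nat} (c p : 'rV[R]_n) :
  differentiable (fun q => enorm (q - c) ^+ 2) p.
Proof.
rewrite sqdistE; apply: differentiable_sum => i.
by apply/differentiableX/differentiableB => //; exact: differentiable_coord.
Qed.

Lemma gradient_sqdist {R : realType} {n : nat} (c p : 'rV[R]_n) :
  gradient (fun q => enorm (q - c) ^+ 2) p = 2 *: (p - c).
Proof.
apply/rowP => j; rewrite !mxE sqdistE.
set v := delta_mx ord0 j.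
have dsum : is_derive p v
    (\sum_(i < n) ((fun q : 'rV[R]_n => q ord0 i) - cst (c ord0 i)) ^+ 2)
    (\sum_(i < n) (2 * (p ord0 i - c ord0 i)) *: v ord0 i).
  apply: is_derive_sum => i.
  have := is_derive_coord i p v => ?.
  by apply: is_derive_eq; rewrite subr0 expr1.
rewrite derive_val (bigD1 j) //= big1 => [|i ij]; first last.
  by rewrite mxE (negbTE ij) andbF scaler0.
by rewrite mxE !eqxx addr0 /GRing.scale /= mulr1.
Qed.

(** Written as a sum of two terms, rather than as one norm of the joint vector,
    so that freezing either argument visibly leaves a constant plus a squared
    distance. *)
Definition bilevel_sqdist {R : realType} {d1 d2 : nat} (X : set 'rV[R]_d1)
    (a : 'rV[R]_d1) (b : 'rV[R]_d2) : objective d2 X :=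
  fun x y => enorm (val x - a) ^+ 2 + enorm (y - b) ^+ 2.

Lemma smooth_bilevel_sqdist {R : realType} {d1 d2 : nat} (X : set 'rV[R]_d1)
    (a : 'rV[R]_d1) (b : 'rV[R]_d2) : smooth (bilevel_sqdist X a b).
Proof.
exists (fun p => enorm (p - row_mx a b) ^+ 2); split=> [x y|x y|].
- by rewrite opp_row_mx add_row_mx enorm_sqr_row_mx.
- exact: differentiable_sqdist.
exists 2 => x x' y y'.
by rewrite !gradient_sqdist -scalerBr enormZ ger0_norm // opprB addrA subrK.
Qed.

(** For a squared distance the strong convexity inequality with modulus [2] is
    an equality, coordinate by coordinate. The constant [k] stands for the
    contribution of the other level. *)
Lemma strongly_convex_sqdist {R : realType} {n : nat} {D : set 'rV[R]_n}
    {h : D -> R} (k : R) (c : 'rV[R]_n) :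
  (forall z, h z = k + enorm (val z - c) ^+ 2) -> strongly_convex 2 h.
Proof.
move=> hE; split=> // x y z a _ zE; rewrite !hE zE.
have -> : enorm (a *: val x + (1 - a) *: val y - c) ^+ 2 =
    a * enorm (val x - c) ^+ 2 + (1 - a) * enorm (val y - c) ^+ 2 -
    a * (1 - a) * enorm (val x - val y) ^+ 2.
  rewrite !enorm_sqr !mulr_sumr -big_split /= -sumrB.
  by apply: eq_bigr => i _; rewrite !mxE; ring.
by rewrite le_eqVlt; apply/orP; left; apply/eqP; field.
Qed.

(** The circularity between an algorithm that reacts to the past moves of its
    adversary and an adversary that reacts to the present decision is resolved
    by recursion on the history: [h n] is the list of the first [n] moves. *)
Lemma adaptive_sequence {D E : Type} (A : seq E -> D) (r : D -> E) :
  exists e : nat -> E, forall t, e t = r (A [seq e s | s <- iota 1 t.-1]).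
Proof.
pose h n := iter n (fun u => rcons u (r (A u))) [::].
exists (fun t => r (A (h t.-1))) => t; congr (r (A _)).
elim: t.-1 => // n IH.
by rewrite -addn1 iotaD map_cat -IH /= cats1 addn1.
Qed.

Definition opposite_sign {R : realType} (x : R) : R := if 0 <= x then -1 else 1.

Lemma opposite_sign_sqr {R : realType} (x : R) : opposite_sign x ^+ 2 = 1.
Proof. by rewrite /opposite_sign; case: ifP => _; rewrite ?sqrrN expr1n. Qed.

(** Since [0] lies between [x] and [opposite_sign x], they are at least as far
    apart as [0] and [opposite_sign x]. *)
Lemma opposite_sign_far {R : realType} (x : R) :
  1 <= (x - opposite_sign x) ^+ 2.
Proof. by rewrite /opposite_sign; case: (lerP 0 x) => ?; nra. Qed.

Lemma signed_delta_sqdist {R : realType} {n : nat} (j : 'I_n) (a b : R) :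
  a ^+ 2 = 1 -> b ^+ 2 = 1 ->
  enorm (a *: delta_mx ord0 j - b *: delta_mx ord0 j : 'rV[R]_n) ^+ 2 <= 4.
Proof.
move=> a1 b1; rewrite -scalerBl enormZ enorm_delta mulr1 real_normK ?num_real //.
(* (a - b)^2 + (a + b)^2 = 2 a^2 + 2 b^2 = 4 *)
by have := sqr_ge0 (a + b); nra.
Qed.

Theorem theorem5 (R : realType) :
  exists c : R, 0 < c /\
  forall (d1 d2 : nat), (0 < d1)%N -> (0 < d2)%N ->
  forall (A : obo_algorithm R d1 d2) (T : nat), (0 < T)%N ->
  exists (X : decision_set R d1) (f g : nat -> objective d2 X)
         (ystar : nat -> X -> 'rV[R]_d2) (xstar : nat -> X),
    obo_instance T f g ystar xstar /\
    c * (1 + S2 T ystar xstar) <= BD_Reg T f ystar xstar (decision A f g).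
Proof.
exists (1 / 8); split; first lra.
move=> [|d1] // [|d2] // _ _ A [|T] // _.
pose X : decision_set R d1.+1 := DecisionSet closedT
  (fun _ _ _ _ _ => in_setT _) (ex_intro _ 0 I).
pose e1 : 'rV[R]_d1.+1 := delta_mx ord0 ord0.
pose e2 : 'rV[R]_d2.+1 := delta_mx ord0 ord0.
pose q (s : R) := bilevel_sqdist X (s *: e1) (s *: e2).
(* The adversary's moves are signs; the algorithm sees them through [q]. *)
have [s sE] := adaptive_sequence
  (fun u => A X [seq (q a, q a) | a <- u])
  (fun x => opposite_sign (val x ord0 ord0)).
pose f t := q (s t).
pose ystar t (x : X) := s t *: e2.
pose xstar t : X := to_setT (s t *: e1).
have fE t x y : f t x y = enorm (val x - s t *: e1) ^+ 2
                          + enorm (y - s t *: e2) ^+ 2 by [].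
have s1 t : s t ^+ 2 = 1 by rewrite sE opposite_sign_sqr.
have enorm0 n : enorm (0 : 'rV[R]_n) = 0.
  by rewrite -(scale0r 0) enormZ normr0 mul0r.
have outerE t x : f t x (ystar t x) = enorm (val x - s t *: e1) ^+ 2.
  by rewrite fE subrr enorm0 expr0n /= mulr0n addr0.
have outer_min t : f t (xstar t) (ystar t (xstar t)) = 0.
  by rewrite outerE subrr enorm0 expr0n.
exists X, f, f, ystar, xstar; split.
  split=> t _.
  - exact: smooth_bilevel_sqdist.
  - exact: smooth_bilevel_sqdist.
  - by exists 2 => x; apply: strongly_convex_sqdist => y; exact: fE.
  - by move=> x y; rewrite outerE fE lerDl sqr_ge0.
  - exists 2; apply: (strongly_convex_sqdist 0 (s t *: e1)) => x.
    by rewrite outerE add0r.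
  - by move=> x; rewrite outer_min outerE sqr_ge0.
have decE t : s t = opposite_sign (val (decision A f f t) ord0 ord0).
  by rewrite {1}sE /decision -map_comp.
have reg : T.+1%:R <= BD_Reg T.+1 f ystar xstar (decision A f f).
  rewrite /BD_Reg.
  have -> : T.+1%:R = \sum_(1 <= t < T.+2) (1 : R).
    by rewrite sumr_const_nat subn1.
  apply: ler_sum => t _.
  rewrite outer_min subr0 outerE.
  apply: le_trans (le_coord_enorm_sqr _ ord0).
  by rewrite !mxE mulr1 decE opposite_sign_far.
have le_sum4 (F : nat -> R) : (forall t, F t <= 4) ->
    \sum_(2 <= t < T.+2) F t <= 4 * T%:R.
  move=> F4; have -> : 4 * T%:R = \sum_(2 <= t < T.+2) (4 : R).
    by rewrite sumr_const_nat subSS subn1 mulr_natr.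
  by apply: ler_sum => t _; exact: F4.
have P4 : P2 T.+1 xstar <= 4 * T%:R.
  by apply: le_sum4 => t; exact: signed_delta_sqdist.
have Y4 : Y2 T.+1 ystar xstar <= 4 * T%:R.
  by apply: le_sum4 => t; exact: signed_delta_sqdist.
apply: le_trans reg; rewrite /S2 -(natr1 T).
lra.
Qed.
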